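(* Let $p,q,n\ge 1$, let $A_1\in\mathbb{R}^{p\times n}$ have full column rank, $A_2\in\mathbb{R}^{q\times n}$, assume that $A_1^TA_1-A_2^TA_2$ is symmetric positive definite, let $S\in\mathbb{R}^{n\times n}$ be symmetric positive definite, and let $\alpha>0$. Then: (i) every eigenvalue $\lambda$ of $\mathscr{P}_{\mathrm{BRS}}^{-1}\mathcal{K}$ satisfies $\lambda\neq 1$; (ii) $\lambda=\frac{1}{\alpha+1}$ is an eigenvalue of $\mathscr{P}_{\mathrm{BRS}}^{-1}\mathcal{K}$, and for every nonzero $w\in\mathrm{Null}(A_2^T)$ the vector $(0,0,w^T)^T\in\mathbb{R}^{p+n+q}$ is a corresponding eigenvector; (iii) if $\lambda\neq\frac1{\alpha+1}$ is an eigenvalue of $\mathscr{P}_{\mathrm{BRS}}^{-1}\mathcal{K}$ with eigenvector $(u^T,v^T,w^T)^T$, where $u\in\mathbb{C}^p$, $v\in\mathbb{C}^n$, $w\in\mathbb{C}^q$, then $v\ne 0$ and $$\bigl((\alpha+1)\hat s+\hat p\bigr)\lambda^2+\bigl(\hat q-2\hat p-\hat s\bigr)\lambda+(\hat p-\hat q)=0,$$ where $\hat s=\frac{v^*Sv}{v^*v}$, $\hat p=\frac{v^*A_1^TA_1v}{v^*v}$ and $\hat q=\frac{v^*A_2^TA_2v}{v^*v}$.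
   Context: The matrices are $$\mathcal{K}=\begin{bmatrix} I_p & A_1 & 0 \\ -A_1^T & 0 & A_2^T \\ 0 & A_2 & I_q \end{bmatrix},\qquad \mathscr{P}_{\mathrm{BRS}}=\begin{bmatrix} (\alpha+1)I_p & A_1 & 0 \\ -A_1^T & S & 0 \\ 0 & A_2 & (\alpha+1)I_q \end{bmatrix}.$$ $\mathrm{Null}(\cdot)$ denotes the null space and $v^*$ the conjugate transpose of $v$. The standing assumption is that $A^T\mathcal{J}A=A_1^TA_1-A_2^TA_2$ is symmetric positive definite, where $A=\begin{bmatrix} A_1 \\ A_2 \end{bmatrix}$ and $\mathcal{J}=\mathrm{diag}(I_p,-I_q)$ with $p,q\ge1$ (indefinite case). *)

(* Defs.v *)
(* MathComp, with the abstract reals of MathComp-Analysis and the complex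
   numbers R[i] of mathcomp-real-closed. *)
From HB Require Import structures.
From mathcomp Require Import all_boot all_order all_algebra.
From mathcomp Require Import complex reals.

Set Implicit Arguments.
Unset Strict Implicit.
Unset Printing Implicit Defensive.

Import Order.TTheory GRing.Theory Num.Theory.
Local Open Scope ring_scope.
Local Open Scope complex_scope.
Local Open Scope sesquilinear_scope.

Definition spd (R : realType) (n : nat) (M : 'M[R]_n) : Prop :=
  M^T = M /\ forall x : 'cV[R]_n, x != 0 -> 0 < (x^T *m M *m x) 0 0.

(* The 3 x 3 block matrices are nested as 1 + (1 + 1) blocks, so that their
   index type is 'I_(p + (n + q)). *)
Definition saddleK (R : realType) (p q n : nat)
    (A1 : 'M[R]_(p, n)) (A2 : 'M[R]_(q, n)) : 'M[R]_(p + (n + q)) :=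
  block_mx 1%:M              (row_mx A1 0)
           (col_mx (- A1^T) 0) (block_mx 0  A2^T
                                         A2 1%:M).

Definition precBRS (R : realType) (p q n : nat)
    (A1 : 'M[R]_(p, n)) (A2 : 'M[R]_(q, n)) (S : 'M[R]_n) (alpha : R) :
    'M[R]_(p + (n + q)) :=
  block_mx (alpha + 1)%:M    (row_mx A1 0)
           (col_mx (- A1^T) 0) (block_mx S  0
                                         A2 (alpha + 1)%:M).

Definition cmx (R : realType) (m n : nat) (M : 'M[R]_(m, n)) : 'M[R[i]]_(m, n) :=
  map_mx (real_complex R) M.

(* P^{-1} K, as a complex matrix.  [invmx] is the inverse only on invertible
   matrices; the preconditioner is invertible when S is symmetric positive
   definite and alpha > 0. *)
Definition precK (R : realType) (p q n : nat)
    (A1 : 'M[R]_(p, n)) (A2 : 'M[R]_(q, n)) (S : 'M[R]_n) (alpha : R) :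
    'M[R[i]]_(p + (n + q)) :=
  cmx (invmx (precBRS A1 A2 S alpha) *m saddleK A1 A2).

Definition vec3 (F : Type) (p q n : nat)
    (u : 'cV[F]_p) (v : 'cV[F]_n) (w : 'cV[F]_q) : 'cV[F]_(p + (n + q)) :=
  col_mx u (col_mx v w).

Definition eigenvector (F : fieldType) (n : nat) (M : 'M[F]_n) (lambda : F)
    (x : 'cV[F]_n) : Prop :=
  x != 0 /\ M *m x = lambda *: x.

(* MathComp's [eigenvalue] is defined with row vectors acting on the left;
   it has the same extension as the column-vector notion. *)
Lemma eigenvalue_colP (F : fieldType) (n : nat) (M : 'M[F]_n) (lambda : F) :
  eigenvalue M lambda <-> exists x : 'cV[F]_n, eigenvector M lambda x.
Proof.
have -> : eigenvalue M lambda = eigenvalue M^T lambda.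
  rewrite !eigenvalue_root_char /char_poly -det_tr; congr (root (\det _) _).
  by apply/matrixP=> i j; rewrite !mxE eq_sym.
split=> [/eigenvalueP[x xM xn0] | [x [xn0 Mx]]].
  exists x^T; split; first by rewrite trmx_eq0.
  by rewrite -[M]trmxK -trmx_mul xM linearZ.
by apply/eigenvalueP; exists x^T; rewrite ?trmx_eq0 // -trmx_mul Mx linearZ.
Qed.

(* The quotient v^* M v / v^* v, where [v ^t*] is the conjugate transpose. *)
Definition rayleigh (R : realType) (n : nat) (M : 'M[R[i]]_n)
    (v : 'cV[R[i]]_n) : R[i] :=
  (v ^t* *m M *m v) 0 0 / (v ^t* *m v) 0 0.

(* Main.v *)
Require Import Defs.
From mathcomp Require Import all_boot all_order all_algebra.
From mathcomp Require Import complex reals ring.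
Import Order.TTheory GRing.Theory Num.Theory.
Local Open Scope ring_scope.
Local Open Scope complex_scope.

(** An eigenpair of P^{-1} K is a solution of the pencil equation
    K x = lambda P x, because P is invertible.  For x = (u, v, w) the pencil
    splits into three block equations ([pencilP]):

      (1 - lambda (alpha + 1)) u = (lambda - 1) A1 v,
      (1 - lambda (alpha + 1)) w = (lambda - 1) A2 v,
      (lambda - 1) A1^T u + A2^T w = lambda S v,

    and all three parts of the theorem are read off from them.

    - For lambda = 1 the first two force u = w = 0, since alpha != 0; the third
      then gives S v = 0, and v = 0 as S is definite.
    - For lambda = 1 / (alpha + 1), v = 0 solves the first two, and the
      third becomes a linear condition on (u, w).  It can be solved for u with
      an arbitrary w, because A1^T has a right inverse when A1 has full column
      rank; as q >= 1, some w is nonzero.  If A2^T w = 0, then u = 0 will do.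
    - For any other lambda, v = 0 would force u = w = 0.  Multiplying the third
      equation by 1 - lambda (alpha + 1) and eliminating u and w gives a
      quadratic matrix polynomial that annihilates v
      ([pencil_Schur_complement]); its Rayleigh quotient at v is the quadratic
      equation.

    The invertibility of P ([precBRS_unit]) comes from the same elimination:
    P x = 0 leaves (S + A1^T A1 / (alpha + 1)) v = 0. *)

(** * The block matrices acting on block vectors *)

Lemma vec3_eq0 {F : fieldType} {p q n : nat}
    (u : 'cV[F]_p) (v : 'cV[F]_n) (w : 'cV[F]_q) :
  (vec3 u v w == 0) = [&& u == 0, v == 0 & w == 0].
Proof. by rewrite /vec3 !col_mx_eq0. Qed.

Lemma vec3_surj {F : fieldType} {p q n : nat} (x : 'cV[F]_(p + (n + q))) :
  exists u v w, x = vec3 u v w.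
Proof.
exists (usubmx x), (usubmx (dsubmx x)), (dsubmx (dsubmx x)).
by rewrite /vec3 !vsubmxK.
Qed.

Lemma vec3_inj {F : fieldType} {p q n : nat}
    (u u' : 'cV[F]_p) (v v' : 'cV[F]_n) (w w' : 'cV[F]_q) :
  vec3 u v w = vec3 u' v' w' <-> [/\ u = u', v = v' & w = w'].
Proof.
split=> [/eq_col_mx[-> /eq_col_mx[-> ->]] // | [-> -> ->] //].
Qed.

Lemma scale_vec3 {F : fieldType} {p q n : nat} (a : F)
    (u : 'cV[F]_p) (v : 'cV[F]_n) (w : 'cV[F]_q) :
  a *: vec3 u v w = vec3 (a *: u) (a *: v) (a *: w).
Proof. by rewrite /vec3 !scale_col_mx. Qed.

Lemma cmx_eq0 {R : realType} {m n : nat} (M : 'M[R]_(m, n)) :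
  (cmx M == 0) = (M == 0).
Proof. exact: map_mx_eq0. Qed.

Lemma cmxM {R : realType} {m n k : nat} (M : 'M[R]_(m, n)) (N : 'M[R]_(n, k)) :
  cmx (M *m N) = cmx M *m cmx N.
Proof. exact: map_mxM. Qed.

Lemma cmx_vec3 {R : realType} {p q n : nat}
    (u : 'cV[R]_p) (v : 'cV[R]_n) (w : 'cV[R]_q) :
  cmx (vec3 u v w) = vec3 (cmx u) (cmx v) (cmx w).
Proof. by rewrite /cmx /vec3 !map_col_mx. Qed.

Lemma mul_precBRS_vec3 {R : realType} {p q n : nat}
    (A1 : 'M[R]_(p, n)) (A2 : 'M[R]_(q, n)) (S : 'M[R]_n) (alpha : R)
    (u : 'cV[R]_p) (v : 'cV[R]_n) (w : 'cV[R]_q) :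
  precBRS A1 A2 S alpha *m vec3 u v w =
  vec3 ((alpha + 1) *: u + A1 *m v) (- (A1^T *m u) + S *m v)
       (A2 *m v + (alpha + 1) *: w).
Proof.
rewrite /precBRS /vec3 !mul_block_col mul_row_col mul_col_mx !mul0mx.
by rewrite !addr0 !mul_scalar_mx mulNmx add_col_mx add0r.
Qed.

Lemma mul_cmx_precBRS_vec3 {R : realType} {p q n : nat}
    (A1 : 'M[R]_(p, n)) (A2 : 'M[R]_(q, n)) (S : 'M[R]_n) (alpha : R)
    (u : 'cV[R[i]]_p) (v : 'cV[R[i]]_n) (w : 'cV[R[i]]_q) :
  cmx (precBRS A1 A2 S alpha) *m vec3 u v w =
  vec3 ((alpha%:C + 1) *: u + cmx A1 *m v) (- (cmx A1^T *m u) + cmx S *m v)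
       (cmx A2 *m v + (alpha%:C + 1) *: w).
Proof.
rewrite /cmx /precBRS /vec3 !(map_block_mx, map_row_mx, map_col_mx).
rewrite !map_mx0 !map_scalar_mx map_mxN !mul_block_col mul_row_col mul_col_mx.
rewrite !mul0mx !addr0 !mul_scalar_mx mulNmx add_col_mx add0r /=.
by rewrite rmorphD rmorph1.
Qed.

Lemma mul_cmx_saddleK_vec3 {R : realType} {p q n : nat}
    (A1 : 'M[R]_(p, n)) (A2 : 'M[R]_(q, n))
    (u : 'cV[R[i]]_p) (v : 'cV[R[i]]_n) (w : 'cV[R[i]]_q) :
  cmx (saddleK A1 A2) *m vec3 u v w =
  vec3 (u + cmx A1 *m v) (- (cmx A1^T *m u) + cmx A2^T *m w)
       (cmx A2 *m v + w).
Proof.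
rewrite /cmx /saddleK /vec3 !(map_block_mx, map_row_mx, map_col_mx).
rewrite !map_mx0 !map_mx1 map_mxN !mul_block_col mul_row_col mul_col_mx.
by rewrite !mul0mx !addr0 !mul1mx mulNmx add_col_mx !add0r.
Qed.

(** * Invertibility of the preconditioner *)

Lemma unitmx_col_inj {F : fieldType} {n : nat} (M : 'M[F]_n) :
  (forall x : 'cV[F]_n, M *m x = 0 -> x = 0) -> M \in unitmx.
Proof.
move=> injM; rewrite -unitmx_tr unitmxE unitfE; apply/det0P => -[y y0 yM].
case/eqP: y0; apply: trmx_inj; rewrite trmx0; apply: injM.
by apply: trmx_inj; rewrite trmx_mul trmxK yM trmx0.
Qed.

Lemma spd_unit {R : realType} {n : nat} (S : 'M[R]_n) : spd S -> S \in unitmx.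
Proof.
move=> [_ posS]; apply: unitmx_col_inj => x Sx0; apply/eqP/negPn/negP.
by move=> /posS; rewrite -mulmxA Sx0 mulmx0 mxE ltxx.
Qed.

Lemma gram_ge0 {R : realType} {n : nat} (x : 'cV[R]_n) : 0 <= (x^T *m x) 0 0.
Proof.
by rewrite mxE; apply: sumr_ge0 => k _; rewrite mxE -expr2 sqr_ge0.
Qed.

(** Eliminating u from P x = 0 yields (alpha + 1) S v = - A1^T A1 v, and
    pairing with v makes the definite left side nonpositive. *)
Lemma precBRS_unit {R : realType} {p q n : nat}
    (A1 : 'M[R]_(p, n)) (A2 : 'M[R]_(q, n)) (S : 'M[R]_n) (alpha : R) :
  spd S -> 0 < alpha -> precBRS A1 A2 S alpha \in unitmx.
Proof.
move=> [_ posS] alpha0; have a1 : 0 < alpha + 1 by rewrite addr_gt0.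
have a1n0 : alpha + 1 != 0 by rewrite gt_eqF.
apply: unitmx_col_inj => x; have [u [v [w ->]]] := vec3_surj x.
rewrite mul_precBRS_vec3 => /eqP; rewrite vec3_eq0 => /and3P[/eqP e1 /eqP e2 /eqP e3].
have Sv : (alpha + 1) *: (S *m v) = - (A1^T *m (A1 *m v)).
  have -> : S *m v = A1^T *m u by apply/eqP; rewrite -subr_eq0 addrC e2.
  by rewrite scalemxAr -mulmxN; move/eqP: e1; rewrite addr_eq0 => /eqP ->.
have v0 : v = 0.
  apply: contraPeq (gram_ge0 (A1 *m v)) => /posS vSv; apply/negP; rewrite -ltNge -oppr_gt0.
  suff -> : - ((A1 *m v)^T *m (A1 *m v)) 0 0 = (alpha + 1) * (v^T *m S *m v) 0 0.
    by rewrite mulr_gt0.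
  have := congr1 (fun z => (v^T *m z) 0 0) Sv; rewrite /= -scalemxAr mxE -mulmxA => ->.
  by rewrite mulmxN trmx_mul -mulmxA [RHS]mxE.
move: e1 e3; rewrite v0 !mulmx0 addr0 add0r => /eqP + /eqP.
rewrite !scalemx_eq0 (negPf a1n0) /= => /eqP -> /eqP ->.
by apply/eqP; rewrite vec3_eq0 !eqxx.
Qed.

(** * The pencil equation *)

Lemma eigenvector_precK {R : realType} {p q n : nat}
    (A1 : 'M[R]_(p, n)) (A2 : 'M[R]_(q, n)) (S : 'M[R]_n) (alpha : R)
    (lambda : R[i]) (x : 'cV[R[i]]_(p + (n + q))) :
  spd S -> 0 < alpha ->
  eigenvector (precK A1 A2 S alpha) lambda x <->
  x != 0 /\ cmx (saddleK A1 A2) *m x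
            = lambda *: (cmx (precBRS A1 A2 S alpha) *m x).
Proof.
move=> hS alpha0; have uP := precBRS_unit A1 A2 S alpha hS alpha0.
rewrite /eigenvector /precK; split=> -[x0 eqx]; split=> //.
  rewrite scalemxAr -eqx mulmxA -cmxM mulmxA mulmxV //.
  by rewrite mul1mx.
by rewrite cmxM -mulmxA eqx -scalemxAr mulmxA -cmxM mulVmx // /cmx map_mx1 mul1mx.
Qed.

Lemma pencilP {R : realType} {p q n : nat}
    (A1 : 'M[R]_(p, n)) (A2 : 'M[R]_(q, n)) (S : 'M[R]_n) (alpha : R)
    (lambda : R[i])
    (u : 'cV[R[i]]_p) (v : 'cV[R[i]]_n) (w : 'cV[R[i]]_q) :
  spd S -> 0 < alpha ->
  eigenvector (precK A1 A2 S alpha) lambda (vec3 u v w) <->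
  vec3 u v w != 0 /\
  [/\ (1 - lambda * (alpha%:C + 1)) *: u = (lambda - 1) *: (cmx A1 *m v),
      (1 - lambda * (alpha%:C + 1)) *: w = (lambda - 1) *: (cmx A2 *m v)
    & (lambda - 1) *: (cmx A1^T *m u) + cmx A2^T *m w = lambda *: (cmx S *m v)].
Proof.
move=> hS alpha0; rewrite eigenvector_precK //.
rewrite mul_cmx_saddleK_vec3 mul_cmx_precBRS_vec3 scale_vec3 vec3_inj.
have sub m (a b c d : 'cV[R[i]]_m) : a - b = c - d -> (a = b <-> c = d).
  by move=> e; split=> h; apply: subr0_eq; [rewrite -e h | rewrite e h]; rewrite subrr.
have E1 : (u + cmx A1 *m v = lambda *: ((alpha%:C + 1) *: u + cmx A1 *m v)) <->
   ((1 - lambda * (alpha%:C + 1)) *: u = (lambda - 1) *: (cmx A1 *m v)).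
  by apply: sub; apply/matrixP=> i j; rewrite !mxE; ring.
have E3 : (cmx A2 *m v + w = lambda *: (cmx A2 *m v + (alpha%:C + 1) *: w)) <->
   ((1 - lambda * (alpha%:C + 1)) *: w = (lambda - 1) *: (cmx A2 *m v)).
  by apply: sub; apply/matrixP=> i j; rewrite !mxE; ring.
have E2 : (- (cmx A1^T *m u) + cmx A2^T *m w
           = lambda *: (- (cmx A1^T *m u) + cmx S *m v)) <->
  ((lambda - 1) *: (cmx A1^T *m u) + cmx A2^T *m w = lambda *: (cmx S *m v)).
  by apply: sub; apply/matrixP=> i j; rewrite !mxE; ring.
by split=> -[x0 [f g h]]; (split=> //; split); by [apply/E1 | apply/E2 | apply/E3].
Qed.

(** Multiplying the third equation by c, instead of dividing the first two by
    it, lets u and w be eliminated even where c = 0.  In the pencil,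
    c = 1 - lambda (alpha + 1). *)
Lemma pencil_Schur_complement {R : realType} {p q n : nat}
    (A1 : 'M[R]_(p, n)) (A2 : 'M[R]_(q, n)) (S : 'M[R]_n) (lambda c : R[i])
    (u : 'cV[R[i]]_p) (v : 'cV[R[i]]_n) (w : 'cV[R[i]]_q) :
  c *: u = (lambda - 1) *: (cmx A1 *m v) ->
  c *: w = (lambda - 1) *: (cmx A2 *m v) ->
  (lambda - 1) *: (cmx A1^T *m u) + cmx A2^T *m w = lambda *: (cmx S *m v) ->
  ((lambda - 1) ^+ 2 *: cmx (A1^T *m A1)
     + ((lambda - 1) *: cmx (A2^T *m A2) + (- (lambda * c)) *: cmx S)) *m v = 0.
Proof.
move=> e1 e3 /(congr1 ( *:%R c)); rewrite scalerDr !scalerA => e2.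
rewrite !mulmxDl -!scalemxAl !cmxM -!mulmxA.
rewrite expr2 -scalerA scalemxAr -e1 [(_ - 1) *: (cmx A2^T *m _)]scalemxAr -e3.
rewrite -!scalemxAr scalerA addrA [(_ - 1) * c]mulrC e2.
by rewrite scaleNr [c * _]mulrC subrr.
Qed.

(** * Rayleigh quotients *)

Lemma rayleigh_linear {R : realType} {n : nat} (a : R[i]) (M N : 'M[R[i]]_n)
    (v : 'cV[R[i]]_n) :
  rayleigh (a *: M + N) v = a * rayleigh M v + rayleigh N v.
Proof.
rewrite /rayleigh mulmxDr mulmxDl -scalemxAr -scalemxAl mxE [X in X + _]mxE.
by rewrite mulrDl mulrA.
Qed.

Lemma rayleigh_kernel {R : realType} {n : nat} (M : 'M[R[i]]_n)
    (v : 'cV[R[i]]_n) :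
  M *m v = 0 -> rayleigh M v = 0.
Proof. by move=> Mv; rewrite /rayleigh -mulmxA Mv mulmx0 mxE mul0r. Qed.

(** * The three spectral statements *)

Lemma precK_eigenvalue_neq1 {R : realType} {p q n : nat}
    (A1 : 'M[R]_(p, n)) (A2 : 'M[R]_(q, n)) (S : 'M[R]_n) (alpha : R)
    (lambda : R[i]) :
  spd S -> 0 < alpha ->
  eigenvalue (precK A1 A2 S alpha) lambda -> lambda != 1.
Proof.
move=> hS alpha0 /eigenvalue_colP[x]; have [u [v [w ->]]] := vec3_surj x.
rewrite pencilP // => -[x0 [e1 e3 e2]]; apply/eqP => l1; case/negP: x0.
have c0 : 1 - lambda * (alpha%:C + 1) != 0.
  rewrite l1 mul1r opprD addrCA subrr addr0 oppr_eq0.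
  by rewrite (fmorph_eq0 (real_complex R)) gt_eqF.
move: e1 e3 e2; rewrite {}l1 in c0 *; rewrite !subrr !scale0r => /eqP + /eqP.
rewrite !scalemx_eq0 (negPf c0) /= => /eqP -> /eqP ->.
rewrite mulmx0 addr0 scale1r => /esym Sv.
have uS : cmx S \in unitmx by rewrite map_unitmx spd_unit.
by rewrite vec3_eq0 !eqxx -(mulKmx uS v) Sv mulmx0 eqxx.
Qed.

(** At lambda = 1 / (alpha + 1) both sides of the first two block equations
    vanish as soon as v = 0. *)
Lemma precK_eigenvector_v0 {R : realType} {p q n : nat}
    (A1 : 'M[R]_(p, n)) (A2 : 'M[R]_(q, n)) (S : 'M[R]_n) (alpha : R)
    (u : 'cV[R]_p) (w : 'cV[R]_q) :
  spd S -> 0 < alpha -> w != 0 ->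
  (1 / (alpha + 1) - 1) *: (A1^T *m u) + A2^T *m w = 0 ->
  eigenvector (precK A1 A2 S alpha) (1 / (alpha + 1))%:C (cmx (vec3 u 0 w)).
Proof.
move=> hS alpha0 w0 e; have a1n0 : alpha + 1 != 0 by rewrite gt_eqF ?addr_gt0.
rewrite cmx_vec3 pencilP // vec3_eq0 !cmx_eq0 (negPf w0) !andbF; split=> //.
have -> : 1 - (1 / (alpha + 1))%:C * (alpha%:C + 1) = 0 :> R[i].
  rewrite -(rmorph1 (real_complex R)) -rmorphD -rmorphM -rmorphB.
  by rewrite divfK // subrr rmorph0.
have -> : cmx (0 : 'cV[R]_n) = 0 by rewrite /cmx map_mx0.
rewrite !mulmx0 !scale0r !scaler0; split=> //.
rewrite -(rmorph1 (real_complex R)) -rmorphB -!cmxM -map_mxZ -map_mxD.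
by rewrite e map_mx0.
Qed.

Lemma precK_eigenvalue_inv {R : realType} {p q n : nat}
    (A1 : 'M[R]_(p, n)) (A2 : 'M[R]_(q, n)) (S : 'M[R]_n) (alpha : R) :
  (0 < q)%N -> \rank A1 = n -> spd S -> 0 < alpha ->
  eigenvalue (precK A1 A2 S alpha) (1 / (alpha + 1))%:C.
Proof.
move=> q0 rkA1 hS alpha0; have a1n0 : alpha + 1 != 0 by rewrite gt_eqF ?addr_gt0.
have [L LA1] : exists L, L *m A1 = 1%:M by apply/row_fullP; rewrite /row_full rkA1.
have w0 : (const_mx 1 : 'cV[R]_q) != 0.
  apply/eqP => /matrixP /(_ (Ordinal q0) 0); rewrite !mxE.
  by apply/eqP; rewrite oner_eq0.
set w : 'cV[R]_q := const_mx 1 in w0; set d := 1 / (alpha + 1) - 1.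
have d0 : d != 0.
  by rewrite subr_eq0 div1r invr_eq1 -subr_eq0 addrK gt_eqF.
apply/eigenvalue_colP.
(* This u solves d A1^T u = - A2^T w, since L^T is a right inverse of A1^T. *)
exists (cmx (vec3 (- d^-1 *: (L^T *m (A2^T *m w))) 0 w)).
apply: precK_eigenvector_v0 => //.
rewrite -/d -scalemxAr [A1^T *m _]mulmxA -[A1^T *m _]trmx_mul LA1 trmx1 mul1mx scalerA mulrN.
by rewrite divff // scaleN1r addNr.
Qed.

Lemma precK_eigenvector_quadratic {R : realType} {p q n : nat}
    (A1 : 'M[R]_(p, n)) (A2 : 'M[R]_(q, n)) (S : 'M[R]_n) (alpha : R)
    (lambda : R[i])
    (u : 'cV[R[i]]_p) (v : 'cV[R[i]]_n) (w : 'cV[R[i]]_q) :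
  spd S -> 0 < alpha -> lambda != (1 / (alpha + 1))%:C ->
  eigenvector (precK A1 A2 S alpha) lambda (vec3 u v w) ->
  v != 0 /\
  ((alpha%:C + 1) * rayleigh (cmx S) v + rayleigh (cmx (A1^T *m A1)) v)
      * lambda ^+ 2
    + (rayleigh (cmx (A2^T *m A2)) v - 2 * rayleigh (cmx (A1^T *m A1)) v
       - rayleigh (cmx S) v) * lambda
    + (rayleigh (cmx (A1^T *m A1)) v - rayleigh (cmx (A2^T *m A2)) v) = 0.
Proof.
move=> hS alpha0 hl; rewrite pencilP // => -[x0 [e1 e3 e2]].
have a1n0 : alpha + 1 != 0 by rewrite gt_eqF ?addr_gt0.
split.
  have c0 : 1 - lambda * (alpha%:C + 1) != 0.
    apply: contra hl; rewrite subr_eq0 => /eqP c1.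
    rewrite rmorphM fmorphV rmorph1 /= rmorphD rmorph1 {1}c1 mulfK //.
    by rewrite -(rmorph1 (real_complex R)) -rmorphD (fmorph_eq0 (real_complex R)).
  apply: contra x0 => /eqP v0; move: e1 e3.
  rewrite v0 !mulmx0 !scaler0 => /eqP + /eqP.
  by rewrite !scalemx_eq0 (negPf c0) /= vec3_eq0 eqxx => -> ->.
have := rayleigh_kernel _ _ (pencil_Schur_complement _ _ _ _ _ _ _ _ e1 e3 e2).
(* The trailing zero matrix gives the last term the shape a *: M + N as well. *)
rewrite !rayleigh_linear -[_ *: cmx S]addr0 rayleigh_linear.
rewrite (rayleigh_kernel 0) ?mul0mx // => <-; ring.
Qed.

Theorem theorem3 (R : realType) (p q n : nat)
  (hp : (1 <= p)%N) (hq : (1 <= q)%N) (hn : (1 <= n)%N)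
  (A1 : 'M[R]_(p, n)) (A2 : 'M[R]_(q, n)) (S : 'M[R]_n) (alpha : R)
  (hA1 : \rank A1 = n)
  (hA : spd (A1^T *m A1 - A2^T *m A2))
  (hS : spd S)
  (halpha : 0 < alpha) :
  [/\ forall lambda : R[i],
        eigenvalue (precK A1 A2 S alpha) lambda -> lambda != 1,
      eigenvalue (precK A1 A2 S alpha) (1 / (alpha + 1))%:C /\
      (forall w : 'cV[R]_q, w != 0 -> A2^T *m w = 0 ->
         eigenvector (precK A1 A2 S alpha) (1 / (alpha + 1))%:C
           (cmx (vec3 0 0 w)))
    & forall (lambda : R[i])
        (u : 'cV[R[i]]_p) (v : 'cV[R[i]]_n) (w : 'cV[R[i]]_q),
        lambda != (1 / (alpha + 1))%:C ->
        eigenvector (precK A1 A2 S alpha) lambda (vec3 u v w) ->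
        v != 0 /\
        let s := rayleigh (cmx S) v in
        let p_ := rayleigh (cmx (A1^T *m A1)) v in
        let q_ := rayleigh (cmx (A2^T *m A2)) v in
        ((alpha%:C + 1) * s + p_) * lambda ^+ 2
          + (q_ - 2 * p_ - s) * lambda + (p_ - q_) = 0].
Proof.
split.
- by move=> lambda; apply: precK_eigenvalue_neq1.
- split=> [|w w0 A2w]; first exact: precK_eigenvalue_inv.
  by apply: precK_eigenvector_v0 => //; rewrite mulmx0 scaler0 add0r.
- by move=> lambda u v w hl hx; apply: precK_eigenvector_quadratic hl hx.
Qed.
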